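(* Let $\lambda>1$, $A=\begin{bmatrix}\lambda&0\\0&1\end{bmatrix}$, $\mathbf{b}\in\mathbb{R}^2$, and let $f:\mathbb{R}^2\to\mathbb{R}$ be the strictly convex quadratic function $f(\mathbf{x})=\frac12\mathbf{x}^{T}A\mathbf{x}-\mathbf{b}^{T}\mathbf{x}$. Let $\{\mathbf{x}_k\}$ be the sequence generated by the PBB method applied to $f$, and let $\mathbf{g}_k=\nabla f(\mathbf{x}_k)$. Then, either $\mathbf{g}_k=\mathbf{0}$ for some finite $k$, or the sequence $\{\|\mathbf{g}_k\|_2\}$ converges to zero at least $R$-linearly.
   Context: PBB (parameterized Barzilai-Borwein) method: given a starting point $\mathbf{x}_1$ and an initial scalar $\alpha_1>0$, iterate $\mathbf{x}_{k+1}=\mathbf{x}_k-\alpha_k^{-1}\mathbf{g}_k$ with $\mathbf{g}_k=\nabla f(\mathbf{x}_k)$ (as long as $\mathbf{g}_k\ne\mathbf{0}$), where for $k\ge2$ one takes $\alpha_k=\alpha_k^{PBB}$ with $$\alpha_k^{PBB}=\frac{(2m_k-1)\mathbf{s}_{k-1}^{T}\mathbf{y}_{k-1}+\sqrt{\big((2m_k-1)\mathbf{s}_{k-1}^{T}\mathbf{y}_{k-1}\big)^2-4m_k(m_k-1)\,\mathbf{s}_{k-1}^{T}\mathbf{s}_{k-1}\,\mathbf{y}_{k-1}^{T}\mathbf{y}_{k-1}}}{2m_k\,\mathbf{s}_{k-1}^{T}\mathbf{s}_{k-1}},$$ $\mathbf{s}_{k-1}=\mathbf{x}_k-\mathbf{x}_{k-1}$,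 $\mathbf{y}_{k-1}=\mathbf{g}_k-\mathbf{g}_{k-1}$, and the interpolation parameters $m_k\in(0,1]$ are arbitrary (they may vary with $k$). A sequence of nonnegative numbers $\{a_k\}$ converges to zero at least $R$-linearly if there exist $C>0$ and $\rho\in(0,1)$ such that $a_k\le C\rho^k$ for all $k$. *)

(* Defs.v *)
From HB Require Import structures.
From mathcomp Require Import all_boot all_order all_algebra.
From mathcomp Require Import all_classical all_reals all_analysis.

Set Implicit Arguments.
Unset Strict Implicit.
Unset Printing Implicit Defensive.

Import Order.TTheory GRing.Theory Num.Theory.
Import numFieldNormedType.Exports.

Local Open Scope ring_scope.

Definition dotc (R : realType) (n : nat) (u v : 'cV[R]_n) : R :=
  (u^T *m v) 0 0.

(* The library norm `|_| on matrices is the sup norm, not the Euclidean one. *)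
Definition norm2 (R : realType) (n : nat) (u : 'cV[R]_n) : R :=
  Num.sqrt (\sum_(i < n) u i 0 ^+ 2).

Definition gradient (R : realType) (n : nat) (f : 'cV[R]_n -> R)
    (x : 'cV[R]_n) : 'cV[R]_n :=
  \col_(i < n) ('D_(delta_mx i 0) f x : R).

Definition quadratic (R : realType) (n : nat) (A : 'M[R]_n) (b : 'cV[R]_n)
    (x : 'cV[R]_n) : R :=
  2^-1 * dotc x (A *m x) - dotc b x.

Definition diag2 (R : realType) (a d : R) : 'M[R]_2 :=
  \matrix_(i < 2, j < 2)
    (nth [::] [:: [:: a; 0]; [:: 0; d]] i)`_j.

(* For mk > 0 and s != 0, this is the larger root t of
   mk * (s.s) * t^2 - (2 mk - 1) * (s.y) * t + (mk - 1) * (y.y) = 0. *)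
Definition alpha_pbb (R : realType) (n : nat) (mk : R) (s y : 'cV[R]_n) : R :=
  ((2 * mk - 1) * dotc s y
     + Num.sqrt (((2 * mk - 1) * dotc s y) ^+ 2
                 - 4 * mk * (mk - 1) * dotc s s * dotc y y))
  / (2 * mk * dotc s s).

(* Iterations are numbered from 1; the values at index 0 play no role. *)
Definition pbb_active (R : realType) (n : nat) (f : 'cV[R]_n -> R)
    (x : nat -> 'cV[R]_n) (k : nat) : Prop :=
  forall j : nat, (1 <= j <= k)%N -> gradient f (x j) <> 0.

(* The method stops at the first vanishing gradient, so x, alpha and m are
   constrained only while it is active; the starting point x 1 is free, and
   the interpolation parameters m k enter from k = 2 on. *)
Record pbb_sequence (R : realType) (n : nat) (f : 'cV[R]_n -> R)
    (x : nat -> 'cV[R]_n) (alpha m : nat -> R) : Prop := PBBSequence {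
  pbb_alpha1 : 0 < alpha 1%N;
  pbb_step : forall k : nat, (1 <= k)%N -> pbb_active f x k ->
    x k.+1 = x k - (alpha k)^-1 *: gradient f (x k);
  pbb_param : forall k : nat, (2 <= k)%N -> pbb_active f x k ->
    0 < m k <= 1;
  pbb_alpha : forall k : nat, (2 <= k)%N -> pbb_active f x k ->
    alpha k = alpha_pbb (m k) (x k - x k.-1)
                (gradient f (x k) - gradient f (x k.-1))
}.

Definition R_linear_to_0 (R : realType) (a : nat -> R) : Prop :=
  exists C rho : R, [/\ 0 < C, 0 < rho < 1 &
    forall k : nat, (1 <= k)%N -> a k <= C * rho ^+ k].

(* Main.v *)
Require Import Defs.
From HB Require Import structures.
From mathcomp Require Import all_boot all_order all_algebra.
From mathcomp Require Import all_classical all_reals all_analysis.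
From mathcomp Require Import ring lra.

Set Implicit Arguments.
Unset Strict Implicit.
Unset Printing Implicit Defensive.

Import Order.TTheory GRing.Theory Num.Theory.
Import numFieldNormedType.Exports.

Local Open Scope ring_scope.

(* Write g_k = (u_k, v_k).  For k >= 2 the scalar alpha_k lies between the two
   Barzilai-Borwein values s.y/s.s and y.y/s.y, hence in [1, lambda].  So v is
   multiplied by 1 - 1/alpha_k <= c := 1 - 1/lambda at each step, and u grows by
   at most the factor lambda.  If |v_(k-1)| <= |u_(k-1)|, then
   s.y/s.s >= (lambda + 1)/2 and u is contracted by c as well at step k;
   otherwise |u_(k+1)| <= lambda^2 |v_(k-1)|, and v already decays like c^k. *)

Lemma dotcC (R : realType) (n : nat) (u v : 'cV[R]_n) : dotc u v = dotc v u.
Proof. by rewrite /dotc -[u^T *m v]trmxK mxE trmx_mul trmxK. Qed.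

Lemma dotcDl (R : realType) (n : nat) (u v w : 'cV[R]_n) :
  dotc (u + v) w = dotc u w + dotc v w.
Proof. by rewrite /dotc linearD mulmxDl mxE. Qed.

Lemma dotcZl (R : realType) (n : nat) (a : R) (u v : 'cV[R]_n) :
  dotc (a *: u) v = a * dotc u v.
Proof. by rewrite /dotc linearZ -scalemxAl mxE. Qed.

Lemma dotc_delta (R : realType) (n : nat) (i : 'I_n) (u : 'cV[R]_n) :
  dotc (delta_mx i 0) u = u i 0.
Proof. by rewrite /dotc trmx_delta -rowE mxE. Qed.

(** For [h != 0] the difference quotient is exactly [d + h * c], which tends to [d]. *)
Lemma derive_quadratic_expansion (R : realType) (V : normedModType R)
    (f : V -> R) (x v : V) (d c : R) :
  (forall h, f (h *: v + x) = f x + h * d + h ^+ 2 * c) -> 'D_v f x = d.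
Proof.
move=> fE; pose e (h : R) := d + h * c.
have -> : d = e 0 by rewrite /e mul0r addr0.
rewrite /derive; apply/cvg_lim => //.
have dc : (e @ 0^' --> e 0)%classic.
  apply: cvgD; first exact: cvg_cst.
  by apply: cvgMl; apply: nbhs_dnbhs.
apply: cvg_trans dc; apply: near_eq_cvg; near=> h.
have h0 : h != 0 by near: h; exact: nbhs_dnbhs_neq.
by rewrite /= fE /e /GRing.scale /=; field.
Unshelve. all: by end_near. Qed.

Lemma gradient_quadratic (R : realType) (n : nat) (A : 'M[R]_n)
    (b x : 'cV[R]_n) :
  A^T = A -> gradient (quadratic A b) x = A *m x - b.
Proof.
move=> AT; apply/matrixP => i j; rewrite ord1 [LHS]mxE [RHS]mxE [(- b) _ _]mxE.
set e := delta_mx i 0.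
(* Symmetry of [A] merges the two cross terms of the expansion, which cancels the factor 1/2. *)
have dotcA u v : dotc u (A *m v) = dotc v (A *m u).
  by rewrite dotcC /dotc trmx_mul AT -mulmxA.
apply: (derive_quadratic_expansion (c := 2^-1 * dotc e (A *m e))) => h.
have -> : (A *m x) i 0 = dotc e (A *m x) by rewrite dotc_delta.
have -> : b i 0 = dotc e b by rewrite dotc_delta.
rewrite /quadratic !(dotcC b) !dotcDl !dotcZl.
rewrite ![dotc _ (A *m (_ + _))]dotcA !dotcDl !dotcZl [dotc x (A *m e)]dotcA.
by field.
Qed.

(** By Cauchy-Schwarz and [m * (1 - m) >= 0] the discriminant is at least [(s.y)^2], so the
    numerator is at least [2 * m * s.y]. *)
Lemma alpha_pbb_ge (R : realType) (n : nat) (m : R) (s y : 'cV[R]_n) :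
  0 < m <= 1 -> 0 < dotc s s -> dotc s y ^+ 2 <= dotc s s * dotc y y ->
  dotc s y / dotc s s <= alpha_pbb m s y.
Proof.
rewrite /alpha_pbb; move: (dotc s s) (dotc s y) (dotc y y) => P S Y.
move=> /andP[m0 m1] P0 CS.
set D := _ - 4 * m * _ * _ * _.
have SD : S <= Num.sqrt D.
  apply: le_trans (ler_norm _) _; rewrite -sqrtr_sqr ler_wsqrtr //.
  rewrite -subr_ge0.
  have -> : D - S ^+ 2 = 4 * (m * (1 - m)) * (P * Y - S ^+ 2).
    by rewrite /D; ring.
  by rewrite !mulr_ge0 // ?subr_ge0 // ltW.
rewrite ler_pdivlMr ?mulr_gt0 //.
have -> : S / P * (2 * m * P) = 2 * m * S by field; rewrite gt_eqF.
by lra.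
Qed.

Lemma alpha_pbb_le (R : realType) (n : nat) (m : R) (s y : 'cV[R]_n) :
  0 < m -> 0 < dotc s s -> 0 < dotc s y ->
  dotc s y ^+ 2 <= dotc s s * dotc y y ->
  alpha_pbb m s y <= dotc y y / dotc s y.
Proof.
rewrite /alpha_pbb; move: (dotc s s) (dotc s y) (dotc y y) => P S Y.
(* Here [t] is the claimed bound, and Cauchy-Schwarz becomes [S <= P * t]. The claim reduces to
   [sqrt D <= r], with [D] the discriminant, hence to [r ^+ 2 - D >= 0], which factors. *)
move=> m0 P0 S0; have [t ->] : exists t, Y = t * S.
  by exists (Y / S); rewrite divfK // gt_eqF.
rewrite mulfK ?gt_eqF // mulrA expr2 ler_pM2r // => SPt.
rewrite ler_pdivrMr ?mulr_gt0 // -lerBrDl.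
set r := (X in _ <= X).
have r0 : 0 <= r.
  have -> : r = 2 * m * (P * t - S) + S by rewrite /r; ring.
  by rewrite addr_ge0 ?mulr_ge0 ?subr_ge0 // ltW.
rewrite -[leRHS](ger0_norm r0) -sqrtr_sqr ler_wsqrtr // -subr_ge0.
set z := (X in 0 <= X).
have -> : z = 4 * m ^+ 2 * (P * t) * (P * t - S) by rewrite /z /r; ring.
have Pt0 : 0 <= P * t := le_trans (ltW S0) SPt.
apply: mulr_ge0; last by rewrite subr_ge0.
by apply: mulr_ge0 => //; rewrite mulr_ge0 ?sqr_ge0.
Qed.

Lemma sum_ord2 (V : nmodType) (F : 'I_2 -> V) : \sum_(i < 2) F i = F 0 + F 1.
Proof.
by rewrite big_ord_recl big_ord1; congr (_ + F _); apply: val_inj.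
Qed.

Lemma dotc2 (R : realType) (u v : 'cV[R]_2) :
  dotc u v = u 0 0 * v 0 0 + u 1 0 * v 1 0.
Proof. by rewrite /dotc mxE sum_ord2 !mxE. Qed.

Lemma diag2_mul0 (R : realType) (a d : R) (u : 'cV[R]_2) :
  (diag2 a d *m u) 0 0 = a * u 0 0.
Proof. by rewrite mxE sum_ord2 !mxE /= mul0r addr0. Qed.

Lemma diag2_mul1 (R : realType) (a d : R) (u : 'cV[R]_2) :
  (diag2 a d *m u) 1 0 = d * u 1 0.
Proof. by rewrite mxE sum_ord2 !mxE /= mul0r add0r. Qed.

Lemma diag2_tr (R : realType) (a d : R) : (diag2 a d)^T = diag2 a d.
Proof.
by apply/matrixP => i j; rewrite !mxE; case: i j => [[|[|//]] ?] [[|[|//]] ?].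
Qed.

(** With [p], [q] the squared components of [s], both Barzilai-Borwein values are weighted means of
    [l] and 1: with weights [p], [q] for the lower one, and [l * p], [q] for the upper one. If
    [q <= p], the lower one is at least the midpoint. *)
Lemma alpha_pbb_diag2_bounds (R : realType) (l m : R) (s : 'cV[R]_2) :
  1 < l -> 0 < m <= 1 -> s != 0 ->
  let a := alpha_pbb m s (diag2 l 1 *m s) in
  [/\ 1 <= a, a <= l & s 1 0 ^+ 2 <= s 0 0 ^+ 2 -> (l + 1) / 2 <= a].
Proof.
move=> l1 m01 s0 a.
have ss0 : 0 < s 0 0 ^+ 2 + s 1 0 ^+ 2.
  rewrite lt0r addr_ge0 ?sqr_ge0 // andbT paddr_eq0 ?sqr_ge0 //.
  apply: contra s0; rewrite !sqrf_eq0 => /andP[/eqP s00 /eqP s10].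
  apply/eqP/matrixP => i j; rewrite ord1 mxE.
  case: i => [[|[|//]] ilt]; [rewrite -[RHS]s00 | rewrite -[RHS]s10];
    by congr (s _ _); apply: val_inj.
have p0 := sqr_ge0 (s 0 0); have q0 := sqr_ge0 (s 1 0).
have ge1 := @alpha_pbb_ge R 2 m s (diag2 l 1 *m s) m01.
have le1 := @alpha_pbb_le R 2 m s (diag2 l 1 *m s) (proj1 (andP m01)).
have E : [/\ dotc s s = s 0 0 ^+ 2 + s 1 0 ^+ 2,
  dotc s (diag2 l 1 *m s) = l * s 0 0 ^+ 2 + s 1 0 ^+ 2 &
  dotc (diag2 l 1 *m s) (diag2 l 1 *m s) = l ^+ 2 * s 0 0 ^+ 2 + s 1 0 ^+ 2].
  by split; rewrite !dotc2 ?diag2_mul0 ?diag2_mul1; ring.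
case: E ge1 le1 => -> -> ->.
move: (s 0 0 ^+ 2) (s 1 0 ^+ 2) p0 q0 ss0 => p q p0 q0 pq0.
have sy0 : 0 < l * p + q by nra.
have CS : (l * p + q) ^+ 2 <= (p + q) * (l ^+ 2 * p + q).
  rewrite -subr_ge0; set z := (X in 0 <= X).
  have -> : z = (l - 1) ^+ 2 * (p * q) by rewrite /z; ring.
  by apply: mulr_ge0; rewrite ?sqr_ge0 ?mulr_ge0.
move=> /(_ pq0 CS) ge1 /(_ pq0 sy0 CS) le1; split.
- by apply: le_trans ge1; rewrite ler_pdivlMr //; nra.
- by apply: le_trans le1 _; rewrite ler_pdivrMr //; nra.
- by move=> qp; apply: le_trans ge1; rewrite ler_pdivlMr //; nra.
Qed.

Lemma delayed_geometric_bound (R : realType) (c L : R) (u v : nat -> R) :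
  0 < c < 1 -> 0 < L ->
  (forall k, 0 <= u k) -> (forall k, 0 <= v k) ->
  (forall k, (2 <= k)%N -> v k.+1 <= c * v k) ->
  (forall k, (2 <= k)%N -> u k.+1 <= L * u k) ->
  (forall k, (2 <= k)%N -> v k.-1 <= u k.-1 -> u k.+1 <= c * u k) ->
  exists2 C, 0 < C & forall k, (1 <= k)%N -> u k + v k <= C * c ^+ k.
Proof.
move=> /andP[c0 c1] L0 u0 v0 vc uL uc.
have ck k : 0 < c ^+ k by rewrite exprn_gt0.
(* One term for [k = 1] and one for the base case [k = 2], where the recursion starts. *)
pose V := v 1%N / c + v 2%N / c ^+ 2.
have V0 : 0 <= V by rewrite addr_ge0 ?divr_ge0 // ltW.
have vV k : (1 <= k)%N -> v k <= V * c ^+ k.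
  case: k => [//|[_|k _]].
    by rewrite -ler_pdivrMr // expr1 lerDl divr_ge0 // ltW.
  elim: k => [|k IH]; first by rewrite -ler_pdivrMr // lerDr divr_ge0 // ltW.
  apply: le_trans (vc _ _) _ => //.
  by rewrite [c ^+ _.+1]exprS mulrCA ler_pM2l.
(* The induction starts at 3, since two growth steps must begin at index 2 or later. The last term
   absorbs the case where [u] is dominated by [v] two indices earlier. *)
pose U := u 1%N / c + u 2%N / c ^+ 2 + u 3%N / c ^+ 3 + L ^+ 2 * V / c ^+ 2.
have uU k : (1 <= k)%N -> u k <= U * c ^+ k.
  have t1 : 0 <= u 1%N / c by rewrite divr_ge0 // ltW.
  have t2 : 0 <= u 2%N / c ^+ 2 by rewrite divr_ge0 // ltW.
  have t3 : 0 <= u 3%N / c ^+ 3 by rewrite divr_ge0 // ltW.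
  have t4 : 0 <= L ^+ 2 * V / c ^+ 2.
    by rewrite divr_ge0 ?mulr_ge0 ?exprn_ge0 // ltW.
  case: k => [//|[_|[_|k _]]].
  - by rewrite -ler_pdivrMr // expr1 /U; lra.
  - by rewrite -ler_pdivrMr // /U; lra.
  elim: k => [|k IH]; first by rewrite -ler_pdivrMr // /U; lra.
  have [vu|/ltW uv] := leP (v k.+2) (u k.+2).
    apply: le_trans (uc k.+3 isT vu) _.
    by rewrite [c ^+ _.+1]exprS mulrCA ler_pM2l.
  apply: (@le_trans _ _ (L ^+ 2 * V * c ^+ k.+2)).
    apply: le_trans (uL _ _) _ => //; rewrite expr2 -!mulrA ler_pM2l //.
    apply: le_trans (uL _ _) _ => //; rewrite ler_pM2l //.
    exact: le_trans uv (vV _ _).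
  rewrite -[k.+4]add2n exprD mulrA ler_pM2r // -ler_pdivrMr // /U.
  by lra.
(* Adding 1 keeps the constant positive even if [U] and [V] vanish. *)
exists (U + V + 1); last first.
  move=> k k1; apply: le_trans (lerD (uU k k1) (vV k k1)) _.
  by rewrite -mulrDl ler_pM2r // lerDl.
apply: ltr_wpDl => //; rewrite addr_ge0 //.
by have := le_trans (u0 1%N) (uU 1%N isT); rewrite pmulr_lge0.
Qed.

Theorem theorem4 (R : realType) (lambda : R) (b : 'cV[R]_2)
    (x : nat -> 'cV[R]_2) (alpha m : nat -> R)
    (f := quadratic (diag2 lambda 1) b) :
  1 < lambda ->
  pbb_sequence f x alpha m ->
  (exists2 k : nat, (1 <= k)%N & gradient f (x k) = 0) \/
  R_linear_to_0 (fun k : nat => norm2 (gradient f (x k))).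
Proof.
move=> l1 [a1 step param alphaE].
have gradE z : gradient f z = diag2 lambda 1 *m z - b.
  by apply: gradient_quadratic; exact: diag2_tr.
have [?|no_zero] := pselect (exists2 k, (1 <= k)%N & gradient f (x k) = 0).
  by left.
right.
(* No gradient vanishes, so the defining equations hold at every index. *)
have act k : pbb_active f x k.
  by move=> j /andP[j1 _] gj; apply: no_zero; exists j.
pose g k := gradient f (x k).
have g0 k : (1 <= k)%N -> g k != 0.
  by move=> k1; apply/eqP => gk; apply: no_zero; exists k.
have gS k i : (1 <= k)%N ->
    g k.+1 i 0 = g k i 0 - (alpha k)^-1 * (diag2 lambda 1 *m g k) i 0.
  move=> k1; rewrite /g [in LHS]gradE step // mulmxBr -scalemxAr addrAC -gradE.
  rewrite -/(g k) [LHS]mxE; congr (_ + _).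
  by rewrite [LHS]mxE; congr (- _); rewrite [LHS]mxE.
have sE k : (1 <= k)%N -> x k.+1 - x k = - (alpha k)^-1 *: g k.
  by move=> k1; rewrite step // addrAC subrr add0r scaleNr.
have yE k : g k.+1 - g k = diag2 lambda 1 *m (x k.+1 - x k).
  by rewrite /g !gradE mulmxBr opprB addrA subrK.
have bounds k : (1 <= k)%N -> 0 < alpha k -> [/\ 1 <= alpha k.+1,
    alpha k.+1 <= lambda & g k 1 0 ^+ 2 <= g k 0 0 ^+ 2 ->
    (lambda + 1) / 2 <= alpha k.+1].
  (* The step is a nonzero multiple of [g k], so comparing its squared components amounts to
     comparing those of [g k]. *)
  move=> k1 ak; have ak' : - (alpha k)^-1 != 0.
    by rewrite oppr_eq0 invr_eq0 gt_eqF.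
  rewrite (alphaE k.+1) //= -/(g k.+1) -/(g k) yE sE //.
  have s0 : - (alpha k)^-1 *: g k != 0 by rewrite scaler_eq0 negb_or ak' g0.
  have [? ? big] := alpha_pbb_diag2_bounds l1 (param k.+1 k1 (act _)) s0.
  split=> // vu; apply: big; rewrite ![(_ *: g k) _ _]mxE !exprMn ler_pM2l //.
  by rewrite lt0r sqrf_eq0 ak' sqr_ge0.
have alpha_gt0 k : (1 <= k)%N -> 0 < alpha k.
  elim: k => [//|[//|k] IH _]; have [ge1 _ _] := bounds k.+1 isT (IH isT).
  exact: lt_le_trans ge1.
pose c := 1 - lambda^-1.
have l0 : 0 < lambda by lra.
have il1 : lambda^-1 < 1 by rewrite invf_lt1.
have il0 : 0 < lambda^-1 by rewrite invr_gt0.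
have c01 : 0 < c < 1 by rewrite /c; lra.
(* The factor [1 - lambda / alpha] is nonpositive, so the absolute value flips its sign. The index
   starts at [alpha 2] because [alpha 1] is only known to be positive. *)
have uS k : (1 <= k)%N ->
    `|g k.+2 0 0| = (lambda - alpha k.+1) / alpha k.+1 * `|g k.+1 0 0|.
  move=> k1; have ak := alpha_gt0 k.+1 isT.
  have [_ le _] := bounds k k1 (alpha_gt0 k k1).
  rewrite -[_ / _]ger0_norm ?divr_ge0 ?subr_ge0 ?(ltW ak) // -normrM -normrN.
  congr `|_|; rewrite gS //.
  by rewrite diag2_mul0; field; rewrite gt_eqF.
have vS k : (1 <= k)%N ->
    `|g k.+2 1 0| = (alpha k.+1 - 1) / alpha k.+1 * `|g k.+1 1 0|.
  move=> k1; have ak := alpha_gt0 k.+1 isT.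
  have [ge1 _ _] := bounds k k1 (alpha_gt0 k k1).
  rewrite -[_ / _]ger0_norm ?divr_ge0 ?subr_ge0 ?(ltW ak) // -normrM.
  congr `|_|; rewrite gS //.
  by rewrite diag2_mul1; field; rewrite gt_eqF.
have ila k : (1 <= k)%N -> lambda^-1 * alpha k.+1 <= 1.
  move=> k1; have [_ le _] := bounds k k1 (alpha_gt0 k k1).
  by rewrite mulrC ler_pdivrMr // mul1r.
have [C C0 gC] : exists2 C, 0 < C &
    forall k, (1 <= k)%N -> `|g k 0 0| + `|g k 1 0| <= C * c ^+ k.
  apply: (delayed_geometric_bound (L := lambda)) => //.
  - move=> [//|[//|k]] _; rewrite vS // ler_wpM2r // ler_pdivrMr ?alpha_gt0 //.
    by have := ila k.+1 isT; rewrite /c mulrBl mul1r; lra.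
  - move=> [//|[//|k]] _; rewrite uS // ler_wpM2r // ler_pdivrMr ?alpha_gt0 //.
    by have [ge1 _ _] := bounds k.+1 isT (alpha_gt0 k.+1 isT); nra.
  - move=> [//|[//|k]] _ /=; rewrite -ler_sqr ?nnegrE // !real_normK ?num_real //.
    move=> vu; rewrite uS // ler_wpM2r // ler_pdivrMr ?alpha_gt0 //.
    (* Being above the midpoint means [lambda - alpha <= alpha - 1], and [alpha - 1 <= c * alpha] as
       for the other component. *)
    have [_ _ /(_ vu)] := bounds k.+1 isT (alpha_gt0 k.+1 isT).
    by have := ila k.+1 isT; rewrite /c mulrBl mul1r; lra.
exists C, c; split=> // k k1; apply: le_trans (gC k k1).
(* The Euclidean norm is at most the sum of absolute values: compare squares. *)
rewrite /norm2 -/(g k) sum_ord2 -[leRHS]ger0_norm ?addr_ge0 // -sqrtr_sqr.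
rewrite ler_wsqrtr // sqrrD !real_normK ?num_real // lerD2r lerDl.
by rewrite mulrn_wge0 ?mulr_ge0.
Qed.
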